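(* Let $K$ be a field, let $n\geq 1$, let $A_1,\ldots,A_n$ be non-empty finite subsets of $K$, let $d_i=|A_i|$, and let $X^*=A_1\times\cdots\times A_n\subset K^n$. For every integer $d\geq 0$, the length of the cartesian code $C_{X^*}(d)$ is $d_1\cdots d_n$; its minimum distance $\delta_{X^*}(d)$ is $1$ if $d\geq \sum_{i=1}^n(d_i-1)$; and its dimension is $$ \dim_K C_{X^*}(d)=\binom{n+d}{d}-\sum_{1\leq i\leq n}\binom{n+d-d_i}{d-d_i}+\sum_{i<j}\binom{n+d-(d_i+d_j)}{d-(d_i+d_j)}-\sum_{i<j<k}\binom{n+d-(d_i+d_j+d_k)}{d-(d_i+d_j+d_k)}+\cdots+(-1)^n\binom{n+d-(d_1+\cdots+d_n)}{d-(d_1+\cdots+d_n)}. $$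
   Context: Let $S=K[t_1,\ldots,t_n]$, let $S_{\leq d}$ be the $K$-vector space of polynomials of $S$ of total degree at most $d$, and let $P_1,\ldots,P_m$ be the points of $X^*$. The evaluation map is $\mathrm{ev}_d\colon S_{\leq d}\to K^{|X^*|}$, $f\mapsto (f(P_1),\ldots,f(P_m))$. The cartesian code $C_{X^*}(d)$ is the image of $\mathrm{ev}_d$ (a $K$-linear subspace; $K$ need not be finite). Its length is $|X^*|$, its dimension is $\dim_K C_{X^*}(d)$, and its minimum distance is $\delta_{X^*}(d)=\min\{\|\mathrm{ev}_d(f)\| : f\in S_{\leq d},\ \mathrm{ev}_d(f)\neq 0\}$, where $\|\cdot\|$ is the number of non-zero entries. Convention: a binomial coefficient $\binom{n+e}{e}$ with $e<0$ is $0$. *)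

(* Defs.v *)
From HB Require Import structures.
From mathcomp Require Import all_boot all_order all_algebra.
From mathcomp Require Import finmap mpoly.

Set Implicit Arguments.
Unset Strict Implicit.
Unset Printing Implicit Defensive.

Import GRing.Theory.

Local Open Scope ring_scope.

Section PolynomialsOfBoundedDegree.
Variables (n : nat) (K : fieldType) (d : nat).

(* [msize p] is 1 + the total degree of [p], and [msize 0 = 0]. *)
Definition deg_le : {pred {mpoly K[n]}} := [pred p | (msize p <= d.+1)%N].

Fact deg_le_submod_closed : submod_closed deg_le.
Proof.
split=> [|c p q]; rewrite !inE ?msize0 // => hp hq.
apply: leq_trans (msizeD_le _ _) _; rewrite geq_max hq andbT.
exact: leq_trans (msizeZ_le _ _) hp.
Qed.

HB.instance Definition _ :=
  GRing.isSubmodClosed.Build K {mpoly K[n]} deg_le deg_le_submod_closed.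

Record mpoly_le := MPolyLe {
  mpoly_of_le :> {mpoly K[n]};
  _ : mpoly_of_le \in deg_le }.

HB.instance Definition _ := [isSub for mpoly_of_le].
HB.instance Definition _ := [Choice of mpoly_le by <:].
HB.instance Definition _ := [SubChoice_isSubLmodule of mpoly_le by <:].

Fact mpoly_le_vecaxiom : vector_axiom #|{: 'X_{1..n < d.+1}}| mpoly_le.
Proof.
pose g (r : 'rV[K]_#|{: 'X_{1..n < d.+1}}|) : {mpoly K[n]} :=
  \sum_(m : 'X_{1..n < d.+1}) r 0 (enum_rank m) *: 'X_[m].
have dg r : g r \in deg_le.
  apply: rpred_sum => m _; apply: rpredZ.
  by rewrite inE msizeX ltnS -ltnS bmdeg.
exists (fun p : mpoly_le => \row_i (val p)@_(enum_val i : 'X_{1..n < d.+1})).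
  by move=> c p q; apply/rowP=> i; rewrite !mxE /= mcoeffD mcoeffZ.
exists (fun r => MPolyLe (dg r)) => [p|r].
  apply/val_inj; rewrite /= /g [RHS](mpolywE (k := d.+1)); last exact: (valP p).
  by apply: eq_bigr => m _; rewrite mxE enum_rankK.
apply/rowP=> i; rewrite mxE /= /g raddf_sum /= (bigD1 (enum_val i)) //=.
rewrite mcoeffZ mcoeffX eqxx mulr1 enum_valK big1 ?addr0 // => m nm.
by rewrite mcoeffZ mcoeffX (inj_eq val_inj) (negbTE nm) mulr0.
Qed.

#[hnf] HB.instance Definition _ :=
  Lmodule_hasFinDim.Build K mpoly_le mpoly_le_vecaxiom.

End PolynomialsOfBoundedDegree.

Section EvaluationCodes.
Variables (n : nat) (K : fieldType) (X : {fset {ffun 'I_n -> K}}) (d : nat).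

(* [#|` X|] is convertible to the size of the duplicate-free sequence
   enumerating [X]. *)
Definition point (i : 'I_#|` X|) : {ffun 'I_n -> K} :=
  tnth (in_tuple (enum_fset X)) i.

Definition ev (f : mpoly_le n K d) : 'rV[K]_#|` X| :=
  \row_i (mpoly_of_le f).@[point i].

Fact ev_is_linear : linear ev.
Proof. by move=> c p q; apply/rowP=> i; rewrite !mxE /= mevalD mevalZ. Qed.

HB.instance Definition _ :=
  GRing.isLinear.Build K (mpoly_le n K d) 'rV[K]_#|` X| _ ev ev_is_linear.

Definition code : {vspace 'rV[K]_#|` X|} := limg (linfun ev).

Lemma codeP (v : 'rV[K]_#|` X|) :
  reflect (exists f : mpoly_le n K d, v = ev f) (v \in code).
Proof.
apply: (iffP memv_imgP) => [[f _ ->]|[f ->]]; exists f.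
- by rewrite lfunE.
- exact: memvf.
- by rewrite lfunE.
Qed.

Definition weight N (v : 'rV[K]_N) : nat := #|[set i | v 0 i != 0]|.

Definition code_length N (C : {vspace 'rV[K]_N}) : nat := N.

(* [w] is the minimum of the set of weights of non-zero codewords; a relation,
   since it is undefined for the zero code. *)
Definition is_min_distance (w : nat) : Prop :=
  (exists2 f : mpoly_le n K d, ev f != 0 & weight (ev f) = w) /\
  (forall f : mpoly_le n K d, ev f != 0 -> (w <= weight (ev f))%N).

End EvaluationCodes.

Section CartesianProduct.
Variables (n : nat) (K : fieldType) (A : 'I_n -> {fset K}).

Definition cartesian : {fset {ffun 'I_n -> K}} :=
  [fset [ffun i => val (f i)] | f : {dffun forall i : 'I_n, A i} in predT]%fset.

Lemma cartesianP (x : {ffun 'I_n -> K}) :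
  reflect (forall i, x i \in A i) (x \in cartesian).
Proof.
apply: (iffP (imfsetP _ _ _ _)) => [[f _ -> i]|xA].
  by rewrite ffunE; apply: valP.
exists [ffun i => [` xA i]%fset : A i] => //.
by apply/ffunP=> i; rewrite !ffunE.
Qed.

End CartesianProduct.

(* The coefficient "n + e choose e", extended by 0 to negative [e]. *)
Definition binomz (n : nat) (e : int) : int :=
  if e is Posz k then ('C(n + k, k))%:Z else 0.

(* Main.v *)
(** List each A_i as a_i0, a_i1, ... and let G_m be the product over i and
    j < m_i of X_i - a_ij, the Newton analogue of the monomial X^m.  Since
    X_i G_m = G_(m + U_i) + a_(i, m_i) G_m, every monomial of degree at most d
    is a combination of polynomials G_m with |m| <= d.  Those with m_i >= d_i
    for some i vanish on the grid; the others are triangular with respect to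
    the nodes (a_(1, m_1), ..., a_(n, m_n)), so their evaluations form a basis
    of the code.  The dimension is thus the number of m with |m| <= d and
    m_i < d_i for all i, and inclusion-exclusion over the violated conditions
    m_i >= d_i yields the alternating sum.  The top reduced polynomial, with
    m_i = d_i - 1, is non-zero at a single grid point. *)

Require Import Defs.
From mathcomp Require Import all_boot all_order all_algebra.
From mathcomp Require Import finmap mpoly.

Set Implicit Arguments.
Unset Strict Implicit.
Unset Printing Implicit Defensive.

Import GRing.Theory.

Local Open Scope ring_scope.

(** * Counting: grid points, inclusion-exclusion, exponent vectors of bounded degree *)

Lemma card_cartesian n (K : fieldType) (A : 'I_n -> {fset K}) :
  #|` cartesian A| = (\prod_(i < n) #|` A i|)%N.
Proof.
rewrite card_imfset /=; last first.
  move=> f g /ffunP fg; apply/ffunP => i; apply: val_inj.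
  by have := fg i; rewrite !ffunE.
rewrite -cardE card_dep_ffun foldrE big_map big_enum /=.
by apply: eq_bigr => i _; rewrite -cardfE.
Qed.

(** The indicator of avoiding every [Q i] is the product of the [1 - Q i x]; expand it over subsets
    [J] and sum over [x]. *)
Lemma inclusion_exclusion (I T : finType) (Q : I -> pred T) :
  (#|[set x | [forall i, ~~ Q i x]]|)%:Z =
  \sum_(J : {set I})
    (-1) ^+ #|J| * (#|[set x | [forall (i | i \in J), Q i x]]|)%:Z.
Proof.
have cardZ (P : pred T) : (#|[set x | P x]|)%:Z = \sum_x (P x)%:Z.
  by rewrite -sum1dep_card big_mkcond -[RHS]raddf_sum /=; congr (Posz _).
have natZ_all (P D : pred I) :
    ([forall (i | D i), P i] : nat)%:Z = \prod_(i | D i) (P i : nat)%:Z.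
  case: forallP => [h|/forallP].
    by rewrite big1 // => i Di; move: (h i); rewrite Di => /= ->.
  rewrite negb_forall => /existsP[i]; rewrite negb_imply => /andP[Di nPi].
  by rewrite (bigD1 i Di) /= (negbTE nPi) mul0r.
rewrite cardZ; under [RHS]eq_bigr do rewrite cardZ mulr_sumr.
rewrite exchange_big /=; apply: eq_bigr => x _.
rewrite (natZ_all (fun i => ~~ Q i x) xpredT).
transitivity (\prod_i (- (Q i x : nat)%:Z + 1)).
  by apply: eq_bigr => i _; case: (Q i x).
rewrite bigA_distr; apply: eq_bigr => J _.
by rewrite natZ_all -big_mkcond /= prodrN.
Qed.

Lemma sum_by_card (V : nmodType) (I : finType) (F : {set I} -> V) :
  \sum_J F J = \sum_(k < #|I|.+1) \sum_(J : {set I} | #|J| == k) F J.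
Proof.
have cardJ (J : {set I}) : (#|J| < #|I|.+1)%N by rewrite ltnS max_card.
by rewrite (partition_big (fun J => Ordinal (cardJ J)) xpredT).
Qed.

(** Reading off the exponents identifies these multi-indices with the [n]-tuples over ['I_d.+1] of
    sum at most [d], whose number is known. *)
Lemma card_bmultinom n d : #|{: 'X_{1..n < d.+1}}| = 'C(n + d, d).
Proof.
pose f (m : 'X_{1..n < d.+1}) : n.-tuple 'I_d.+1 := [tuple inord (m i) | i < n].
have lef (m : 'X_{1..n < d.+1}) i : (m i < d.+1)%N.
  by apply: leq_ltn_trans (bmdeg m); rewrite mdegE (bigD1 i) //= leq_addr.
have f_inj : injective f.
  move=> m1 m2 e; apply/val_inj/mnmP => i; rewrite /=.
  by move/(congr1 (fun t => val (tnth t i))): e; rewrite !tnth_mktuple /= !inordK.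
have -> : 'C(n + d, d) = 'C(n + d, n) by rewrite -[in RHS]bin_sub ?leq_addr // addKn.
rewrite -card_partial_ord_partitions -cardsT -(card_imset _ f_inj).
congr #|pred_of_set _|; apply/setP => t; rewrite inE big_tuple; apply/imsetP/idP.
  move=> [m _ ->]; under eq_bigr do rewrite tnth_mktuple inordK //.
  by rewrite -mdegE -ltnS bmdeg.
move=> le_t.
have mP : (mdeg [multinom tnth t i : nat | i < n] < d.+1)%N.
  by rewrite mdegE ltnS; under eq_bigr do rewrite mnmE.
exists (BMultinom mP) => //; apply: eq_from_tnth => i.
by rewrite tnth_mktuple /= mnmE; apply: val_inj; rewrite /= inordK.
Qed.

(** Let [u] be [b] on [J] and 0 elsewhere. Adding [u] maps the vectors of degree at most
    [d - mdeg u] bijectively onto the counted ones. *)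
Lemma card_bmultinom_ge n d (J : {set 'I_n}) (b : 'I_n -> nat) :
  (#|[set m : 'X_{1..n < d.+1} | [forall (i | i \in J), (b i <= m i)%N]]|)%:Z
    = binomz n (d%:Z - (\sum_(i in J) b i)%:Z).
Proof.
pose u : 'X_{1..n} := [multinom if i \in J then b i else 0 | i < n]%N.
have uE : mdeg u = (\sum_(i in J) b i)%N.
  by rewrite mdegE [RHS]big_mkcond; apply: eq_bigr => i _; rewrite mnmE.
have uP (m : 'X_{1..n}) : [forall (i | i \in J), (b i <= m i)%N] = (u <= m)%MM.
  by apply/forallP/mnm_lepP => h i; move: (h i); rewrite mnmE; case: (i \in J).
rewrite -uE; case: (leqP (mdeg u) d) => [le_ud|lt_du]; last first.
  (* Exhibit the negative integer [d - mdeg u] as a [Negz], where [binomz] computes to 0. *)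
  rewrite -opprB subzn 1?ltnW // -[(_ - d)%N]prednK ?subn_gt0 // -NegzE /=.
  apply/eqP; rewrite eqz_nat cards_eq0 -subset0; apply/subsetP => m.
  rewrite !inE uP => /mnm_lepP le_um; have := bmdeg m.
  rewrite ltnS leqNgt (leq_trans lt_du) // !mdegE; exact: leq_sum.
rewrite subzn //= -card_bmultinom -cardsT.
have gP (m : 'X_{1..n < (d - mdeg u).+1}) : (mdeg (m + u) < d.+1)%N.
  by rewrite mdegD ltnS -[leqRHS](subnK le_ud) leq_add2r -ltnS bmdeg.
have g_inj : injective (fun m => BMultinom (gP m)).
  move=> m1 m2 /(congr1 val) /= /mnmP e; apply/val_inj/mnmP => i.
  by have := e i; rewrite !mnmDE => /addIn.
rewrite -(card_imset _ g_inj); congr (Posz #|pred_of_set _|).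
apply/setP => m; rewrite inE uP.
apply/idP/imsetP => [le_um|[m' _ ->]]; last exact: lem_addl.
have mP : (mdeg (m - u)%MM < (d - mdeg u).+1)%N.
  by rewrite ltnS -(leq_add2r (mdeg u)) -mdegD submK // subnK // -ltnS bmdeg.
by exists (BMultinom mP) => //; apply: val_inj; rewrite /= submK.
Qed.

(** * Triangular families of vectors *)

Section TriangularFamily.
Variables (K : fieldType) (N : nat) (I : finType) (P : pred I).
Variables (F : I -> 'rV[K]_N) (h : I -> nat).
Hypothesis triangF : forall i, P i -> exists2 s : 'I_N, F i 0 s != 0 &
  forall j, P j -> j != i -> (h i <= h j)%N -> F j 0 s = 0.

(** Read a linear relation at the coordinate [s] attached to [i]: terms with [h j >= h i] vanish
    there, and those of smaller [h] have zero coefficient by induction, so the coefficient of [F i]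
    is 0. *)
Lemma dim_span_triangular : \dim <<[seq F i | i in P]>> = #|P|.
Proof.
rewrite -(size_image F P); apply/eqP; rewrite -/(free _).
apply/(@freeP _ _ _ (image_tuple F P)) => k; under eq_bigr do rewrite (nth_image 0).
move=> sumF0 i; have [t] := ubnP (h (enum_val i)); elim: t i => // t IHt i lt_ht.
have [s Fis Fjs] := triangF (enum_valP i).
move/(congr1 (fun v : 'rV_N => v 0 s)): sumF0.
rewrite summxE mxE (bigD1 i) //= big1 ?addr0 => [|j ji]; rewrite mxE.
  by move/eqP; rewrite mulf_eq0 (negbTE Fis) orbF => /eqP.
case: (leqP (h (enum_val i)) (h (enum_val j))) => [le_ij|lt_ji].
  rewrite Fjs ?mulr0 //; first exact: enum_valP.
  by apply: contraNneq ji => /enum_val_inj ->.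
by rewrite IHt ?mul0r // (leq_trans lt_ji).
Qed.

End TriangularFamily.

(** * Newton polynomials *)

Section Newton.
Variables (n : nat) (K : fieldType) (a : 'I_n -> nat -> K).

Definition newton (m : 'X_{1..n}) : {mpoly K[n]} :=
  \prod_(i < n) \prod_(j < m i) ('X_i - (a i j)%:MP).

Lemma newton0 : newton 0 = 1.
Proof. by rewrite /newton big1 // => i _; rewrite mnm0E big_ord0. Qed.

Lemma newtonDU m i :
  newton (m + U_(i)) = ('X_i - (a i (m i))%:MP) * newton m.
Proof.
rewrite /newton !(bigD1 i (P := xpredT)) //= mnmDE mnm1E eqxx addn1 big_ord_recr /=.
rewrite mulrA [_ * ('X_i - _)]mulrC; congr (_ * _).
by apply: eq_bigr => j ji; rewrite mnmDE mnm1E eq_sym (negbTE ji) addn0.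
Qed.

Lemma mnm_ind (P : 'X_{1..n} -> Prop) :
  P 0%MM -> (forall m i, P m -> P (m + U_(i))%MM) -> forall m, P m.
Proof.
move=> P0 PS m; have [d] := ubnP (mdeg m); elim: d m => // d IHd m.
have [->//|] := eqVneq m 0%MM.
rewrite -mdeg_eq0 {1}mdegE sum_nat_eq0 negb_forall => /existsP[i mi] lt_md.
have Uim : (U_(i) <= m)%MM by rewrite lep1mP.
rewrite -(submK Uim) in lt_md *; apply/PS/IHd.
by rewrite mdegD mdeg1 addn1 in lt_md.
Qed.

Lemma msize_newton m : (msize (newton m) <= (mdeg m).+1)%N.
Proof.
elim/mnm_ind: m => [|m i IHm]; first by rewrite newton0 mdeg0 msize1.
rewrite newtonDU mdegD mdeg1 addn1 mulrBl.
apply: leq_trans (msizeD_le _ _) _; rewrite msizeN geq_max.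
rewrite mul_mpolyC (leq_trans (msizeZ_le _ _)) ?(leqW IHm) // andbT.
have [->|nz] := eqVneq (newton m) 0; first by rewrite mulr0 msize0.
rewrite msizeM //; first by rewrite msizeX mdeg1.
by rewrite -msize_poly_eq0 msizeX.
Qed.

Lemma meval_newton m (x : 'I_n -> K) :
  (newton m).@[x] = \prod_(i < n) \prod_(j < m i) (x i - a i j).
Proof.
rewrite /newton rmorph_prod; apply: eq_bigr => i _.
by rewrite /= rmorph_prod; apply: eq_bigr => j _; rewrite /= mevalB mevalXU mevalC.
Qed.

Lemma meval_newton_neq0 (m : 'X_{1..n}) (x : 'I_n -> K) :
  reflect (forall i j, (j < m i)%N -> x i != a i j) ((newton m).@[x] != 0).
Proof.
rewrite meval_newton; apply: (iffP (prodf_neq0 _ _)) => h i => [j lt_j|_].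
  by have /prodf_neq0/(_ (Ordinal lt_j) isT) := h i isT; rewrite subr_eq0.
by apply/prodf_neq0 => j _; rewrite subr_eq0 h.
Qed.

End Newton.

(** * A basis of the cartesian code, and its minimum distance *)

Section CartesianCode.
Variables (n : nat) (K : fieldType) (A : 'I_n -> {fset K}) (d : nat).

Let X := cartesian A.
(* Past the d_i elements of [A i] the nodes take the junk value 0; any value
   would do, as the factors indexed by [A i] already vanish on the grid. *)
Let a i := nth 0 (enum_fset (A i)).

Lemma newton_proof (m : 'X_{1..n < d.+1}) : newton a m \in @deg_le n K d.
Proof. exact: leq_trans (msize_newton _ _) (bmdeg m). Qed.

Let G m : mpoly_le n K d := MPolyLe (newton_proof m).

Lemma point_mem (k : 'I_#|` X|) : point k \in X.
Proof. exact: mem_tnth. Qed.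

Lemma point_inj : injective (@point n K X).
Proof. by apply/tuple_uniqP/fset_uniq. Qed.

Lemma point_surj x : x \in X -> exists k : 'I_#|` X|, point k = x.
Proof. by move=> /(seq_tnthP (s := enum_fset X))[k ->]; exists k. Qed.

Lemma node_in i x : x \in A i -> exists2 j, (j < #|` A i|)%N & x = a i j.
Proof. by move=> /(nthP 0)[j ltj <-]; exists j. Qed.

Definition reduced : pred 'X_{1..n < d.+1} :=
  fun m => [forall i, ~~ (#|` A i| <= m i)%N].

Lemma ev_newton_eq0 m : ~~ reduced m -> ev X (G m) = 0.
Proof.
rewrite negb_forall => /existsP[i]; rewrite negbK => le_im.
apply/rowP => k; rewrite !mxE; apply: contraTeq isT => /meval_newton_neq0 nz.
have /cartesianP/(_ i)/node_in[j lt_j xj] := point_mem k.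
by move: (nz i j (leq_trans lt_j le_im)); rewrite xj eqxx.
Qed.

(** This gives the diagonal entries of the triangular system: [A i] is enumerated without
    repetition, so [a i (m i)] differs from each [a i j] with [j < m i]. *)
Lemma node_point m : reduced m ->
  exists2 k : 'I_#|` X|, point k = [ffun i => a i (m i)]
                       & (newton a m).@[point k] != 0.
Proof.
move=> /forallP redm; have lt_m i : (m i < #|` A i|)%N by rewrite ltnNge.
have [|k kE] := @point_surj [ffun i => a i (m i)].
  by apply/cartesianP => i; rewrite ffunE mem_nth.
exists k => //; apply/meval_newton_neq0 => i j lt_j.
by rewrite kE ffunE nth_uniq ?fset_uniq ?(ltn_trans lt_j) // gtn_eqF.
Qed.

Lemma code_span : code X d = <<[seq ev X (G m) | m in reduced]>>%VS.
Proof.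
apply/eqP; rewrite eqEsubv; apply/andP; split; last first.
  by apply/span_subvP => _ /imageP[m _ ->]; apply/codeP; exists (G m).
set W := <<_>>%VS.
(* Evaluation without a degree bound, so that products can be evaluated freely. *)
pose e (p : {mpoly K[n]}) : 'rV_#|` X| := \row_k p.@[point k].
have e_add p q : e (p + q) = e p + e q by apply/rowP=> k; rewrite !mxE mevalD.
have eZ c p : e (c *: p) = c *: e p by apply/rowP=> k; rewrite !mxE mevalZ.
have e0 : e 0 = 0 by apply/rowP=> k; rewrite !mxE meval0.
(* Quantifying over [m'] lets each variable of the monomial be absorbed into the Newton factor; the
   case [m' = 0] is the one needed. *)
have XnewtonW m m' : (mdeg m + mdeg m' <= d)%N -> e ('X_[m] * newton a m') \in W.
  elim/mnm_ind: m m' => [|m i IHm] m'.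
    rewrite mdeg0 mpolyX0 mul1r -ltnS => lt_m'; pose bm := BMultinom lt_m'.
    rewrite -[e _]/(ev X (G bm)); have [redm|/ev_newton_eq0->] := boolP (reduced bm).
      by apply: memv_span; apply: image_f.
    exact: mem0v.
  rewrite mdegD mdeg1 => le_d; rewrite mpolyXD -mulrA.
  have -> : 'X_i * newton a m' = newton a (m' + U_(i)) + a i (m' i) *: newton a m'.
    by rewrite newtonDU mulrBl mul_mpolyC subrK.
  rewrite mulrDr e_add -scalerAr eZ rpredD ?rpredZ // IHm //.
    by rewrite mdegD mdeg1 addnA addnAC.
  by rewrite (leq_trans _ le_d) // leq_add2r leq_addr.
apply/subvP => _ /codeP[f ->]; rewrite -[ev X f]/(e f).
rewrite (mpolywE (valP f)) (big_morph e e_add e0) rpred_sum // => m _.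
rewrite eZ rpredZ // -[X in e X]mulr1 -(newton0 a) XnewtonW // mdeg0 addn0.
by rewrite -ltnS bmdeg.
Qed.

Lemma dim_code_reduced : \dim (code X d) = #|reduced|.
Proof.
rewrite code_span.
apply: (dim_span_triangular (h := fun m : 'X_{1..n < d.+1} => mdeg m)) => m redm.
have [k kE nz] := node_point redm; exists k; first by rewrite mxE.
(* If [newton a m'] is non-zero at the node of [m], then no [m' i] exceeds [m i]; as
   [mdeg m <= mdeg m'], this forces [m' = m]. *)
move=> m' redm' ne le_m; rewrite mxE; apply: contraNeq ne => /meval_newton_neq0.
rewrite kE => nz'.
have le' i : (m' i <= m i)%N.
  by rewrite leqNgt; apply/negP => /(nz' i); rewrite ffunE eqxx.
have le_m'm : (m' <= m)%MM by apply/mnm_lepP.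
rewrite bmeqP -(submK le_m'm) -[X in X == _]add0m eqm_add2r eq_sym -mdeg_eq0.
by rewrite -leqn0 -(leq_add2r (mdeg m')) -mdegD submK.
Qed.

Lemma min_distance1 : (forall i, A i != fset0) ->
  (\sum_(i < n) (#|` A i| - 1) <= d)%N -> is_min_distance X d 1.
Proof.
move=> A_n0 le_d; have A_gt0 i : (0 < #|` A i|)%N by rewrite cardfs_gt0.
split=> [|f /rV0Pn[k nz]]; last by apply/card_gt0P; exists k; rewrite inE.
have mP : (mdeg [multinom (#|` A i| - 1)%N | i < n] < d.+1)%N.
  by rewrite ltnS mdegE; under eq_bigr do rewrite mnmE.
pose m := BMultinom mP.
have [|k kE nz] := @node_point m.
  by apply/forallP => i; rewrite mnmE -ltnNge subn1 prednK.
have supp : [set l | ev X (G m) 0 l != 0] = [set k].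
  apply/setP => l; rewrite !inE mxE; apply/idP/eqP => [/meval_newton_neq0 nzl|-> //].
  apply: point_inj; rewrite kE; apply/ffunP => i; rewrite ffunE.
  have /cartesianP/(_ i)/node_in[j lt_j xj] := point_mem l.
  rewrite xj; congr a; apply/eqP; rewrite eqn_leq mnmE.
  rewrite leq_subRL // add1n lt_j /= leqNgt.
  by apply/negP => lt_jm; move: (nzl i j); rewrite mnmE lt_jm xj eqxx => /(_ isT).
exists (G m); last by rewrite /weight supp cards1.
by apply/rV0Pn; exists k; rewrite mxE.
Qed.

End CartesianCode.

Theorem theorem3p1 (K : fieldType) (n : nat) (hn : (0 < n)%N)
    (A : 'I_n -> {fset K}) (hA : forall i : 'I_n, A i != fset0) (d : nat) :
  [/\ code_length (code (cartesian A) d) = (\prod_(i < n) #|` A i|)%N,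
      (\sum_(i < n) (#|` A i| - 1) <= d)%N ->
        is_min_distance (cartesian A) d 1
    & (\dim (code (cartesian A) d))%:Z =
        \sum_(k < n.+1) (-1) ^+ k *
          \sum_(J : {set 'I_n} | #|J| == k)
            binomz n (d%:Z - (\sum_(i in J) #|` A i|)%:Z)].
Proof.
split; [exact: card_cartesian | exact: min_distance1 |].
rewrite dim_code_reduced -cardsE inclusion_exclusion sum_by_card card_ord.
apply: eq_bigr => k _; rewrite mulr_sumr; apply: eq_bigr => J /eqP <-.
by rewrite card_bmultinom_ge.
Qed.
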